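(* Let $\mathcal{M}=(E,\rho)$ be a $q$-polymatroid with denominator $\mu$ and set $\mathcal{I}_\mu:=\mathcal{I}_\mu(\mathcal{M})$. Then: (I1) $\mathcal{I}_\mu\neq\emptyset$; in fact $\{0\}\in\mathcal{I}_{\mu}$. (I2) If $I\in\mathcal{I}_\mu$ and $J\leq I$, then $J\in\mathcal{I}_\mu$. (I3) If $I,J\in\mathcal{I}_\mu$ and $\dim I<\dim J$, then there exists $x\in J\setminus I$ such that $I\oplus\langle x\rangle\in\mathcal{I}_\mu$. (I4) Let $V,W\in\mathcal{V}(E)$ and let $I\leq V$, $J\leq W$ be $\mu$-bases of $V$ and $W$, respectively. Then there exists a $\mu$-basis of $V+W$ that is contained in $I+J$.
   Context: Throughout, $\mathbb{F}=\mathbb{F}_q$ is a finite field and $E$ is a finite-dimensional $\mathbb{F}$-vector space. $V\leq W$ means that $V$ is a subspace of $W$, $\mathcal{V}(E)$ is the set of all subspaces of $E$, and $\langle x\rangle$ is the span of $x$. A $q$-rank function on $E$ is a map $\rho:\mathcal{V}(E)\to\mathbb{Q}_{\geq0}$ such that for all $V,W\in\mathcal{V}(E)$: (R1) $0\leq\rho(V)\leq\dim V$; (R2) $V\leq W$ implies $\rho(V)\leq\rho(W)$; (R3) $\rho(V+W)+\rho(V\cap W)\leq\rho(V)+\rho(W)$. A $q$-polymatroid on $E$ is a pair $\mathcal{M}=(E,\rho)$ with $\rho$ a $q$-rank function on $E$. A number $\mu\in\mathbb{Q}_{>0}$ is a denominator of $\mathcal{M}$ if $\mu\rho(V)\in\mathbb{N}_0$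 for all $V\in\mathcal{V}(E)$. Let $\mathcal{M}=(E,\rho)$ be a $q$-polymatroid with denominator $\mu$. A space $I\in\mathcal{V}(E)$ is $\mu$-independent if $\rho(J)\geq\frac{\dim J}{\mu}$ for all subspaces $J\leq I$. Set $\mathcal{I}_\mu(\mathcal{M})=\{I\in\mathcal{V}(E)\mid I \text{ is } \mu\text{-independent}\}$ and, for $V\in\mathcal{V}(E)$, $\mathcal{I}_\mu(V)=\{I\in\mathcal{I}_\mu(\mathcal{M})\mid I\leq V\}$. A $\mu$-basis of $V$ is a space $\hat{I}\in\mathcal{I}_\mu(V)$ with $\dim\hat{I}=\max\{\dim I\mid I\in\mathcal{I}_\mu(V)\}$. *)

(* Defs.v *)
From mathcomp Require Import all_boot all_order all_algebra.

Set Implicit Arguments.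
Unset Strict Implicit.
Unset Printing Implicit Defensive.

Import Order.TTheory GRing.Theory Num.Theory.
Local Open Scope ring_scope.

Definition is_qrank_function (F : finFieldType) (E : vectType F)
    (rho : {vspace E} -> rat) : Prop :=
  [/\ forall V : {vspace E}, 0 <= rho V <= (\dim V)%:R,
      forall V W : {vspace E}, (V <= W)%VS -> rho V <= rho W
    & forall V W : {vspace E},
        rho (V + W)%VS + rho (V :&: W)%VS <= rho V + rho W].

Record qpolymatroid (F : finFieldType) (E : vectType F) := QPolymatroid {
  qrank :> {vspace E} -> rat;
  qrankP : is_qrank_function qrank
}.

Section MuIndependence.

Variables (F : finFieldType) (E : vectType F) (M : qpolymatroid E) (mu : rat).
Implicit Types I J V : {vspace E}.

Definition is_denominator : Prop :=
  0 < mu /\ forall V, mu * M V \in Num.nat.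

Definition mu_independent I : Prop :=
  forall J, (J <= I)%VS -> (\dim J)%:R / mu <= M J.

Definition mu_independent_in V I : Prop :=
  mu_independent I /\ (I <= V)%VS.

Definition mu_basis V I : Prop :=
  mu_independent_in V I /\
  forall J, mu_independent_in V J -> (\dim J <= \dim I)%N.

End MuIndependence.

(* Main.v *)
Require Import Defs.
From mathcomp Require Import all_boot all_order all_algebra.
From mathcomp Require Import zify.

Set Implicit Arguments.
Unset Strict Implicit.
Unset Printing Implicit Defensive.

Import Order.TTheory GRing.Theory Num.Theory.
Local Open Scope ring_scope.

(** Clearing denominators, [f V := mu * M V] is a natural-number valued,
    monotone, submodular function on subspaces with [f 0 = 0], and [I] is
    mu-independent exactly when [\dim J <= f J] for all [J <= I].

    As for integer polymatroids on sets, such an [f] induces the rank function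
    of a genuine q-matroid, namely
      [r V = min_(X <= V) (f X + \dim V - \dim X)],
    and the mu-independent spaces are exactly those with [r I = \dim I]: the
    inequality [\dim I <= f X + \dim I - \dim X] for all [X <= I] is
    mu-independence ([induced_rank_eq_dim]).  Submodularity of [r] follows from
    that of [f] and the modularity of [\dim] ([induced_rank_submod]).

    Everything then takes place in the q-matroid.  If no vector of [W] increases
    the rank of [V], then neither does [W] itself ([rank_add_span_le]); hence an
    independent [I] of dimension below [r W] can be extended by a vector of [W]
    ([rank_augment]), which gives (I3) because [r J = \dim J] for an independent
    [J].  Iterating, every [V] contains an independent space of dimension [r V],
    so that the bases of [V] are its independent subspaces of dimension [r V].
    For (I4), [I] has full rank in [V] and [J] in [W], so submodularity gives
    [r (V + W) <= r (I + J)], and any basis of [I + J] is a basis of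
    [V + W]. *)

(** * Rank functions of q-matroids *)

Section QMatroidRank.

Variables (F : fieldType) (E : vectType F) (r : {vspace E} -> nat).
Implicit Types (V W I J K : {vspace E}) (x : E) (s : seq E).

Hypothesis rank_le_dim : forall V, (r V <= \dim V)%N.
Hypothesis rank_mono : forall V W, (V <= W)%VS -> (r V <= r W)%N.
Hypothesis rank_submod :
  forall V W, (r (V + W)%VS + r (V :&: W)%VS <= r V + r W)%N.

(** Adding the vectors of [s] one at a time, submodularity applied to
    [V + <[x]>] and [V + <<s>>], whose intersection contains [V], shows that
    rank increments over [V] are subadditive. *)
Lemma rank_add_span_le V s :
  (forall x, x \in s -> (r (V + <[x]>)%VS <= r V)%N) ->
  (r (V + <<s>>)%VS <= r V)%N.
Proof.
elim: s => [|x s IHs] no_gain; first by rewrite span_nil addv0.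
have rVx : (r (V + <[x]>)%VS <= r V)%N by apply: no_gain; rewrite mem_head.
have rVs : (r (V + <<s>>)%VS <= r V)%N.
  by apply: IHs => y ys; apply: no_gain; rewrite in_cons ys orbT.
have := rank_submod (V + <[x]>) (V + <<s>>).
have -> : (V + <[x]> + (V + <<s>>) = V + <<x :: s>>)%VS.
  by rewrite span_cons Monoid.mulmACA /= addvv.
have : (r V <= r ((V + <[x]>) :&: (V + <<s>>))%VS)%N.
  by apply: rank_mono; rewrite subv_cap !addvSl.
lia.
Qed.

(** Otherwise no vector of a basis of [W] would increase the rank of [I], and
    [r W <= r (I + W) <= r I] would contradict the assumption on dimensions. *)
Lemma rank_augment I W :
  r I = \dim I -> (\dim I < r W)%N ->
  exists x, [/\ x \in W, x \notin I, directv (I + <[x]>)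
              & r (I + <[x]>)%VS = \dim (I + <[x]>)].
Proof.
move=> rI ltIW.
have [/hasP[x xW gain]|/hasPn no_gain] :=
    boolP (has (fun x => r I < r (I + <[x]>)%VS)%N (vbasis W)); last first.
  have := @rank_add_span_le I (vbasis W).
  rewrite (span_basis (vbasisP W)) => noW.
  have {noW} rIW : (r (I + W)%VS <= r I)%N.
    by apply: noW => x xW; rewrite leqNgt no_gain.
  have := rank_mono (addvSr I W); lia.
have := rank_le_dim (I + <[x]>).
have := (dimv_add_leqif I <[x]>).1.
have := dim_vline x; have := leq_b1 (x != 0) => x_le1 dimx dimIx rIx.
(* [\dim I < r (I + <[x]>) <= \dim (I + <[x]>) <= \dim I + 1], so equality
   holds in the last two places. *)
exists x; split.
- exact: vbasis_mem.
- apply: contraTN gain => xI.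
  by rewrite (addv_idPl _) ?ltnn // -memvE.
- by rewrite directvEgeq /=; lia.
- lia.
Qed.

(** Repeated augmentation, starting from the zero space. *)
Lemma rank_basis_exists V :
  exists K, [/\ (K <= V)%VS, r K = \dim K & \dim K = r V].
Proof.
suff H n : (n <= r V)%N ->
    exists K, [/\ (K <= V)%VS, r K = \dim K & \dim K = n] by exact: H.
elim: n => [_|n IHn ltnV].
  exists 0%VS; split; rewrite ?sub0v ?dimv0 //.
  by apply/eqP; rewrite -leqn0 -[leqRHS](@dimv0 _ E) rank_le_dim.
have [K [KV rK dimK]] := IHn (ltnW ltnV).
have [|x [xV xK dx rKx]] := @rank_augment K V rK; first by rewrite dimK.
exists (K + <[x]>)%VS; split=> //.
  by rewrite subv_add KV -memvE.
have x_neq0 : x != 0 by apply: contraNneq xK => ->; rewrite mem0v.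
by move: dx; rewrite directvE /= dim_vline x_neq0 dimK addn1 => /eqP.
Qed.

(** Submodularity applied to [V] and [U + W]: their sum is [V + W], and their
    intersection contains [U], hence already has the rank of [V]. *)
Lemma rank_addl_full V W U :
  (U <= V)%VS -> r U = r V -> (r (V + W)%VS <= r (U + W)%VS)%N.
Proof.
move=> UV rU; have := rank_submod V (U + W).
rewrite addvA (addv_idPl UV).
have : (r U <= r (V :&: (U + W))%VS)%N.
  by apply: rank_mono; rewrite subv_cap UV addvSl.
lia.
Qed.

Lemma rank_add_full V W I J :
  (I <= V)%VS -> r I = r V -> (J <= W)%VS -> r J = r W ->
  (r (V + W)%VS <= r (I + J)%VS)%N.
Proof.
move=> IV rI JW rJ; apply: leq_trans (rank_addl_full W IV rI) _.
by rewrite addvC [(I + J)%VS]addvC; apply: rank_addl_full.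
Qed.

End QMatroidRank.

(** * The q-matroid induced by an integer q-polymatroid *)

(** Over a finite field there are finitely many subspaces, as each one is
    encoded by its canonical generating matrix; minima over subspaces can thus
    be taken with the finite-type machinery. *)
Definition subspaces (F : finFieldType) (E : vectType F) : finType :=
  can_type (@VectorInternalTheory.vs2mxK F E).

Section InducedRank.

Variables (F : finFieldType) (E : vectType F) (f : {vspace E} -> nat).
Implicit Types V W X I : {vspace E}.

Hypothesis f_mono : forall V W, (V <= W)%VS -> (f V <= f W)%N.
Hypothesis f_submod :
  forall V W, (f (V + W)%VS + f (V :&: W)%VS <= f V + f W)%N.

Let cost V X := (f X + (\dim V - \dim X))%N.

Definition induced_rank V :=
  cost V [arg min_(X < (0%VS : subspaces E) | (X <= V)%VS) cost V X].

Lemma induced_rank_attained V :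
  exists2 X, (X <= V)%VS & induced_rank V = (f X + (\dim V - \dim X))%N.
Proof.
rewrite /induced_rank; case: arg_minnP => [|X XV _]; first exact: sub0v.
by exists X.
Qed.

Lemma induced_rank_le V X :
  (X <= V)%VS -> (induced_rank V <= f X + (\dim V - \dim X))%N.
Proof.
rewrite /induced_rank; case: arg_minnP => [|Y _ minY]; first exact: sub0v.
exact: minY.
Qed.

(** If [X] is optimal for [W], then [V :&: X] competes for [V], and it has
    codimension at most that of [X] in [W]. *)
Lemma induced_rank_mono V W :
  (V <= W)%VS -> (induced_rank V <= induced_rank W)%N.
Proof.
move=> VW; have [X XW ->] := induced_rank_attained W.
have := induced_rank_le (capvSl V X).
have := f_mono (capvSr V X).
have := dimv_sum_cap V X.
have : (\dim (V + X) <= \dim W)%N by rewrite dimvS // subv_add VW.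
have := dimvS XW; have := dimvS (capvSl V X); lia.
Qed.

(** Sum and intersection of optimal spaces for [V] and [W] compete for
    [V + W] and [V :&: W]; the dimension terms match by modularity. *)
Lemma induced_rank_submod V W :
  (induced_rank (V + W)%VS + induced_rank (V :&: W)%VS
     <= induced_rank V + induced_rank W)%N.
Proof.
have [X XV ->] := induced_rank_attained V.
have [Y YW ->] := induced_rank_attained W.
have := induced_rank_le (addvS XV YW); have := induced_rank_le (capvS XV YW).
have := f_submod X Y; have := dimv_sum_cap X Y; have := dimv_sum_cap V W.
have := dimvS XV; have := dimvS YW.
have := dimvS (addvS XV YW); have := dimvS (capvS XV YW); lia.
Qed.

Hypothesis f0 : f 0%VS = 0%N.

Lemma induced_rank_le_dim V : (induced_rank V <= \dim V)%N.
Proof. by have := induced_rank_le (sub0v V); rewrite f0 dimv0; lia. Qed.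

(** The bound [\dim I <= f X + (\dim I - \dim X)] says exactly that
    [\dim X <= f X]. *)
Lemma induced_rank_eq_dim I :
  induced_rank I = \dim I <-> forall J, (J <= I)%VS -> (\dim J <= f J)%N.
Proof.
split=> [rI J JI|indI].
  by have := induced_rank_le JI; have := dimvS JI; lia.
have := induced_rank_le_dim I; have [X XI ->] := induced_rank_attained I.
by have := indI X XI; have := dimvS XI; lia.
Qed.

End InducedRank.

(** * Application to mu-independence *)

Section MuRank.

Variables (F : finFieldType) (E : vectType F) (M : qpolymatroid E) (mu : rat).
Hypothesis hmu : is_denominator M mu.
Implicit Types V W I J K : {vspace E}.

Definition scaled_rank V : nat := Num.truncn (mu * M V).

Lemma scaled_rankE V : (scaled_rank V)%:R = mu * M V.
Proof. by apply/eqP; rewrite -natrEtruncn; case: hmu => _; apply. Qed.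

Lemma scaled_rank0 : scaled_rank 0%VS = 0%N.
Proof.
have [bnd _ _] := qrankP M; have := bnd 0%VS.
rewrite dimv0 -eq_le => /eqP M0.
by apply/eqP; rewrite -(eqr_nat rat) scaled_rankE -M0 mulr0.
Qed.

Lemma scaled_rank_mono V W : (V <= W)%VS -> (scaled_rank V <= scaled_rank W)%N.
Proof.
move=> VW; have [_ mono _] := qrankP M; have [mu_gt0 _] := hmu.
by rewrite -(ler_nat rat) !scaled_rankE ler_pM2l // mono.
Qed.

Lemma scaled_rank_submod V W :
  (scaled_rank (V + W)%VS + scaled_rank (V :&: W)%VS
     <= scaled_rank V + scaled_rank W)%N.
Proof.
have [_ _ submod] := qrankP M; have [mu_gt0 _] := hmu.
by rewrite -(ler_nat rat) !natrD !scaled_rankE -!mulrDr ler_pM2l // submod.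
Qed.

Definition mu_rank V : nat := induced_rank scaled_rank V.

Lemma mu_rank_le_dim V : (mu_rank V <= \dim V)%N.
Proof. exact: induced_rank_le_dim scaled_rank0 V. Qed.

Lemma mu_rank_mono V W : (V <= W)%VS -> (mu_rank V <= mu_rank W)%N.
Proof. exact: (induced_rank_mono scaled_rank_mono). Qed.

Lemma mu_rank_submod V W :
  (mu_rank (V + W)%VS + mu_rank (V :&: W)%VS <= mu_rank V + mu_rank W)%N.
Proof. exact: induced_rank_submod scaled_rank_submod V W. Qed.

Lemma mu_independentE I : mu_independent M mu I <-> mu_rank I = \dim I.
Proof.
have [mu_gt0 _] := hmu.
have leE J : ((\dim J)%:R / mu <= M J) = (\dim J <= scaled_rank J)%N.
  by rewrite ler_pdivrMr // mulrC -scaled_rankE ler_nat.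
split=> [indI|/(induced_rank_eq_dim scaled_rank0) indI].
  by apply/(induced_rank_eq_dim scaled_rank0) => J JI; rewrite -leE indI.
by move=> J JI; rewrite leE indI.
Qed.

(** The condition on the right no longer quantifies over competing subspaces:
    the maximal dimension of an independent subspace of [V] is at most
    [mu_rank V] by monotonicity, and reaches it by augmentation. *)
Lemma mu_basisE V K :
  mu_basis M mu V K <->
  [/\ (K <= V)%VS, mu_rank K = \dim K & \dim K = mu_rank V].
Proof.
split=> [[[/mu_independentE indK KV] maxK]|[KV indK dimK]].
  split=> //.
  have [B [BV indB dimB]] :=
    rank_basis_exists mu_rank_le_dim mu_rank_mono mu_rank_submod V.
  have : (\dim B <= \dim K)%N by apply: maxK; split=> //; apply/mu_independentE.
  have := mu_rank_mono KV; lia.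
split; first by split=> //; apply/mu_independentE.
move=> J [/mu_independentE indJ JV].
by rewrite -indJ dimK mu_rank_mono.
Qed.

End MuRank.

Theorem corollary3p12 (F : finFieldType) (E : vectType F)
    (M : qpolymatroid E) (mu : rat) (hmu : is_denominator M mu) :
  [/\ (* (I1) *)
      (exists I : {vspace E}, mu_independent M mu I) /\
      mu_independent M mu 0%VS,
      (* (I2) *)
      forall I J : {vspace E},
        mu_independent M mu I -> (J <= I)%VS -> mu_independent M mu J,
      (* (I3) *)
      forall I J : {vspace E},
        mu_independent M mu I -> mu_independent M mu J ->
        (\dim I < \dim J)%N ->
        exists x : E, [/\ x \in J, x \notin I, directv (I + <[x]>)
                        & mu_independent M mu (I + <[x]>)%VS]
    & (* (I4) *)
      forall V W I J : {vspace E},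
        mu_basis M mu V I -> mu_basis M mu W J ->
        exists K : {vspace E},
          mu_basis M mu (V + W)%VS K /\ (K <= I + J)%VS].
Proof.
have r_dim := mu_rank_le_dim hmu.
have r_mono := mu_rank_mono hmu.
have r_submod := mu_rank_submod hmu.
have ind0 : mu_independent M mu 0%VS.
  by apply/(mu_independentE hmu); apply/eqP; rewrite eqn_leq r_dim dimv0.
split.
- by split=> //; exists 0%VS.
- by move=> I J indI JI K KJ; apply/indI/(subv_trans KJ).
- move=> I J /(mu_independentE hmu) indI /(mu_independentE hmu) indJ.
  rewrite -indJ => ltIJ.
  have [x [xJ xI dx indIx]] := rank_augment r_dim r_mono r_submod indI ltIJ.
  by exists x; split=> //; apply/(mu_independentE hmu).
- move=> V W I J /(mu_basisE hmu)[IV indI dimI] /(mu_basisE hmu)[JW indJ dimJ].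
  have [K [KIJ indK dimK]] := rank_basis_exists r_dim r_mono r_submod (I + J)%VS.
  exists K; split=> //; apply/(mu_basisE hmu); split=> //.
    exact: subv_trans KIJ (addvS IV JW).
  apply/eqP; rewrite dimK eqn_leq r_mono ?addvS //=.
  by apply: rank_add_full; rewrite ?indI ?indJ.
Qed.
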